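(* Let $S=\{s_1,\dots,s_{|S|}\}$ be a finite set, $G=G_S$ the free group on $S$, and let $\theta_1,\dots,\theta_{|S|}$ be positive real numbers. Consider the multi-dimensional-time dynamical system on the circle generated by $f_i(x)=x+\theta_i \bmod 1$, $i=1,\dots,|S|$. For $t=s_{i_1}^{\varepsilon_1}\cdots s_{i_m}^{\varepsilon_m}\in G$ put $q(t)=\varepsilon_1\theta_{i_1}+\cdots+\varepsilon_m\theta_{i_m}$. Then for any subgroup $H$ of $G$ $$\mathrm{Per}_H\left(D^G_{\theta_1,\dots,\theta_{|S|}}\right)=\begin{cases}\emptyset, & \text{if } q(t_0)\notin\mathbb{Z}\text{ for some } t_0\in H;\\ [0,1), & \text{if } q(t)\in\mathbb{Z}\text{ for all } t\in H.\end{cases}$$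
   Context: The phase space is $X=[0,1]$ with the boundary points $0$ and $1$ identified (i.e. the circle $\mathbb{R}/\mathbb{Z}$), and $a\bmod 1=a-[a]\in[0,1)$, where $[a]$ is the integer part of $a$. For $t=s_{i_1}^{\varepsilon_1}\cdots s_{i_n}^{\varepsilon_n}\in G$ with $\varepsilon_j\in\mathbb{Z}$ and $x\in X$, $D_t(x)=f_{i_n}^{\varepsilon_n}(\cdots f_{i_1}^{\varepsilon_1}(x)\cdots)=(x+\varepsilon_1\theta_{i_1}+\cdots+\varepsilon_n\theta_{i_n})\bmod 1$. For a subgroup $H$ of $G$, a point $x$ is called $H$-periodic if $D_{rt}(x)=D_t(x)$ for all $t\in G$ and all $r\in H$; $\mathrm{Per}_H(D^G_{\theta_1,\dots,\theta_{|S|}})$ denotes the set of $H$-periodic points. *)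

(* Defs.v *)
From HB Require Import structures.
From mathcomp Require Import all_boot all_order all_algebra.
From mathcomp Require Import all_classical all_reals.

Set Implicit Arguments.
Unset Strict Implicit.
Unset Printing Implicit Defensive.

Import Order.TTheory GRing.Theory Num.Theory.
Local Open Scope ring_scope.
Local Open Scope classical_set_scope.

Section FreeGroup.
Variable S : choiceType.

(* The letter (s, true) stands for s and (s, false) for s^-1, so that
   s ^ e with e an integer is spelled with `|e| equal letters. *)
Definition letter : Type := (S * bool)%type.

Definition letter_inv (a : letter) : letter := (a.1, ~~ a.2).

Definition reduced : pred (seq letter) :=
  sorted (fun a b : letter => b != letter_inv a).

Record free_group : Type :=
  FreeGroup { word : seq letter; word_reduced : reduced word }.

HB.instance Definition _ := [isSub for word].
HB.instance Definition _ := [Choice of free_group by <:].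

(* Left multiplication of a reduced word by a letter. *)
Definition push (a : letter) (w : seq letter) : seq letter :=
  if w is b :: w' then if b == letter_inv a then w' else a :: w else [:: a].

Lemma letter_invK : involutive letter_inv.
Proof. by case=> s b; rewrite /letter_inv /= negbK. Qed.

Lemma push_reduced a w : reduced w -> reduced (push a w).
Proof.
case: w => [//|b w] /=; case: (eqVneq b (letter_inv a)) => [_|ba] h /=.
  exact: path_sorted h.
by rewrite ba.
Qed.

Lemma foldr_push_reduced u v : reduced v -> reduced (foldr push v u).
Proof. by move=> hv; elim: u => //= a u; apply: push_reduced. Qed.

Lemma pushK a w : reduced w -> push (letter_inv a) (push a w) = w.
Proof.
case: w => [|b w] /=; first by rewrite letter_invK eqxx.
case: (eqVneq b (letter_inv a)) => [->|_] /=; last by rewrite letter_invK eqxx.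
by case: w => [//|c w] /= /andP[/negPf ->].
Qed.

Lemma pushVK a w : reduced w -> push a (push (letter_inv a) w) = w.
Proof. by move=> hw; rewrite -{1}[a]letter_invK pushK. Qed.

Lemma foldr_push_push a w v : reduced w ->
  foldr push w (push a v) = push a (foldr push w v).
Proof.
move=> hw; case: v => [//|b v] /=; case: eqP => [->|//] /=.
by rewrite pushVK //; apply: foldr_push_reduced.
Qed.

Lemma foldr_push_nil w : reduced w -> foldr push [::] w = w.
Proof.
elim: w => [//|a [//|b w] IH] /= /andP[/negPf ab hw].
by rewrite /= in IH; rewrite (IH hw) /= ab.
Qed.

Definition word_inv (w : seq letter) : seq letter := rev (map letter_inv w).

Lemma word_inv_reduced w : reduced w -> reduced (word_inv w).
Proof.
rewrite /reduced /word_inv rev_sorted sorted_map; apply: sub_sorted => a b /=.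
by rewrite letter_invK eq_sym.
Qed.

Lemma foldr_pushV w v : reduced v ->
  foldr push (foldr push v w) (word_inv w) = v.
Proof.
rewrite /word_inv => hv; elim: w => [//|a w IH] /=.
by rewrite rev_cons foldr_rcons pushK //; apply: foldr_push_reduced.
Qed.

Definition fg_one : free_group := @FreeGroup [::] isT.
Definition fg_inv (t : free_group) : free_group :=
  FreeGroup (word_inv_reduced (word_reduced t)).
Definition fg_mul (t u : free_group) : free_group :=
  FreeGroup (foldr_push_reduced (word t) (word_reduced u)).

Lemma fg_mulA : associative fg_mul.
Proof.
move=> [u hu] [v hv] [w hw]; apply: val_inj => /=.
by elim: u {hu} => //= a u ->; rewrite foldr_push_push.
Qed.

Lemma fg_mul1 : left_id fg_one fg_mul.
Proof. by move=> t; apply: val_inj. Qed.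

Lemma fg_mulr1 : right_id fg_one fg_mul.
Proof. by move=> [w hw]; apply: val_inj; apply: foldr_push_nil. Qed.

Lemma fg_mulV : left_inverse fg_one fg_inv fg_mul.
Proof.
move=> [w hw]; apply: val_inj => /=.
by rewrite -{1}(foldr_push_nil hw) foldr_pushV.
Qed.

Lemma fg_invK : involutive fg_inv.
Proof.
move=> [w hw]; apply: val_inj; rewrite /= /word_inv map_rev revK.
exact: mapK letter_invK _.
Qed.

Lemma fg_mulrV : right_inverse fg_one fg_inv fg_mul.
Proof. by move=> t; rewrite -{1}[t]fg_invK fg_mulV. Qed.

HB.instance Definition _ := isGroup.Build free_group
  fg_mulA fg_mul1 fg_mulr1 fg_mulV fg_mulrV.

End FreeGroup.

Section Circle.
Variable R : realType.

(* The circle [0, 1] / (0 ~ 1), each point given by its representative in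
   [0, 1). *)
Record circle : Type :=
  Circle { cval : R; cval_itv : (0 <= cval) && (cval < 1) }.

Lemma mod1_itv (a : R) :
  (0 <= a - (Num.floor a)%:~R) && (a - (Num.floor a)%:~R < 1).
Proof.
have /andP[h1 h2] := floor_itv a.
by rewrite subr_ge0 h1 ltrBlDl -[X in _ + X]/(1%:~R) -intrD.
Qed.

Definition mod1 (a : R) : circle := Circle (mod1_itv a).

Definition rotation (theta : R) (x : circle) : circle := mod1 (cval x + theta).

Lemma circle_inj : injective cval.
Proof.
by move=> [x hx] [y hy] /= e; subst y; rewrite (bool_irrelevance hx hy).
Qed.

Lemma rotationK theta : cancel (rotation theta) (rotation (- theta)).
Proof.
move=> x; apply: circle_inj => /=.
set n := Num.floor (cval x + theta).
have -> : cval x + theta - n%:~R - theta = cval x + (- n)%:~R.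
  by rewrite addrAC addrK rmorphN.
rewrite (@floor_def _ _ (- n)); first by rewrite addrK.
have /andP[h0 h1] := cval_itv x.
by rewrite lerDr h0 intrD addrC ltrD2l.
Qed.

Lemma rotationNK theta : cancel (rotation (- theta)) (rotation theta).
Proof. by move=> x; rewrite -{1}[theta]opprK rotationK. Qed.

End Circle.

Section System.
Variables (S : choiceType) (X : Type).

(* The system generated by the bijections f s, with inverses g s.  The first
   letter of t acts first, whence dyn (r * t) = dyn t \o dyn r. *)
Definition dyn (f g : S -> X -> X) (t : free_group S) (x : X) : X :=
  foldl (fun y a => if a.2 then f a.1 y else g a.1 y) x (word t).

Definition Per (D : free_group S -> X -> X) (H : set (free_group S)) : set X :=
  [set x | forall r t, H r -> D (r * t)%g x = D t x].

End System.

(* rotation (- theta s) is the inverse of rotation (theta s), see rotationK and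
   rotationNK. *)
Definition rotation_dyn (R : realType) (S : choiceType) (theta : S -> R) :
    free_group S -> circle R -> circle R :=
  dyn (fun s => rotation (theta s)) (fun s => rotation (- theta s)).

Definition q (R : realType) (S : choiceType) (theta : S -> R)
    (t : free_group S) : R :=
  \sum_(a <- word t) (if a.2 then theta a.1 else - theta a.1).

(* Main.v *)
(* Rotations compose additively, so D_t x = (x + q t) mod 1, and q is a
   homomorphism from the free group to (R, +). Hence x is H-periodic iff
   q r + q t and q t agree modulo Z for all r in H and all t, a condition in
   which x no longer occurs. *)
Require Import Defs.
From mathcomp Require Import all_boot all_order all_algebra.
From mathcomp Require Import all_classical all_reals.

Import Order.TTheory GRing.Theory Num.Theory.
Local Open Scope ring_scope.
Local Open Scope classical_set_scope.

Section Mod1.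
Variable R : realType.
Implicit Types (a b : R) (x : circle R).

(** Left to right, equal fractional parts make [a - b] a difference of two floors; right to left,
    the floor commutes with integer shifts. *)
Lemma mod1_eqP a b : mod1 a = mod1 b <-> a - b \is a Num.int.
Proof.
split=> [/(congr1 (@cval R))/= ab|/intrP[n abn]].
  have -> : a - b = (Num.floor a)%:~R - (Num.floor b)%:~R.
    by apply/eqP; rewrite subr_eq addrAC -addrA -ab addrC subrK.
  by rewrite rpredB // intr_int.
apply: circle_inj => /=; have -> : a = b + n%:~R by rewrite -abn addrC subrK.
by rewrite floorDrz ?intr_int// intrKfloor intrD opprD addrACA subrr addr0.
Qed.

Lemma mod1_cval x : mod1 (cval x) = x.
Proof.
apply: circle_inj; rewrite /= (@floor_def _ _ 0) ?subr0 //.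
by rewrite add0r cval_itv.
Qed.

(** A rotation may act on any real representative: the floor removed by [mod1 a] changes the sum by
    an integer only. *)
Lemma rotation_mod1 theta a : rotation theta (mod1 a) = mod1 (a + theta).
Proof.
apply/mod1_eqP => /=.
by rewrite opprD addrACA subrr addr0 addrAC subrr add0r rpredN intr_int.
Qed.

End Mod1.

Section RotationSystem.
Variables (R : realType) (S : choiceType) (theta : S -> R).
Implicit Types (r t : free_group S) (x : circle R).

Let step (a : letter S) : R := if a.2 then theta a.1 else - theta a.1.

(** When [push] cancels [a] against the head of [w], their steps are opposite, so free reduction
    preserves the sum. *)
Lemma sum_step_push (a : letter S) w :
  \sum_(b <- push a w) step b =
    step a + \sum_(b <- w) step b.
Proof.
case: w => [|b w] /=; first by rewrite big_seq1 big_nil addr0.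
case: eqP => [->|_]; last by rewrite big_cons.
by rewrite big_cons /step; case: a => s [] /=; rewrite addrA ?subrr ?addNr add0r.
Qed.

Lemma qM r t : q theta (r * t)%g = q theta r + q theta t.
Proof.
rewrite /q /=; elim: (word r) => [|a w IH] /=; first by rewrite big_nil add0r.
by rewrite sum_step_push IH big_cons addrA.
Qed.

Lemma rotation_dynE t x : rotation_dyn theta t x = mod1 (cval x + q theta t).
Proof.
(* Writing [x] as [mod1 (cval x)] lets the induction run over an arbitrary real [y], since partial
   sums may leave [0, 1). *)
rewrite /rotation_dyn /dyn /q -[in LHS](mod1_cval _ x).
elim: (word t) (cval x) => [|a w IH] y /=; first by rewrite big_nil addr0.
by rewrite !rotation_mod1 -!fun_if IH big_cons addrA; case: a.2.
Qed.

Lemma Per_rotation_dynP (H : set (free_group S)) x :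
  Per (rotation_dyn theta) H x <-> forall r, H r -> q theta r \is a Num.int.
Proof.
have dynP r t : rotation_dyn theta (r * t)%g x = rotation_dyn theta t x <->
    q theta r \is a Num.int.
  rewrite !rotation_dynE mod1_eqP qM.
  by rewrite opprD addrACA subrr add0r addrK.
split=> [xP r Hr|qH r t Hr]; last exact/dynP/qH.
(* The right-hand side of [dynP] is independent of [t], so testing periodicity at the identity
   suffices. *)
by apply/(dynP r 1%g)/xP.
Qed.

End RotationSystem.

Theorem theorem6p2 (R : realType) (S : finType) (theta : S -> R)
    (theta_gt0 : forall s, 0 < theta s)
    (H : set (free_group S)) (H_group : group_closed (mem H)) :
  ((exists2 t0, H t0 & q theta t0 \isn't a Num.int) ->
     Per (rotation_dyn theta) H = set0) /\
  ((forall t, H t -> q theta t \is a Num.int) ->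
     [set cval x | x in Per (rotation_dyn theta) H] = `[0, 1[).
Proof.
split=> [[t0 Ht0 /negP qt0]|qH].
  by rewrite -subset0 => x /Per_rotation_dynP/(_ t0 Ht0).
apply/seteqP; split=> y /=; rewrite in_itv /=.
  (* Every point of the circle has its representative in [0, 1); conversely [y], with its bounds, is
     itself a point. *)
  by move=> [x _ <-]; exact: cval_itv.
by move=> y01; exists (Circle y01) => //; apply/Per_rotation_dynP.
Qed.
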